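(* There exist no totally umbilical proper QGCR-lightlike submanifolds $(M,g,S(TM),S(TM^\perp))$ of an indefinite nearly Sasakian manifold $(\overline{M},\overline{\phi},\eta,\xi,\overline{g})$ with the structure vector field $\xi$ tangent to $M$ (that is, $\xi\in\Gamma(TM)$ along $M$).
   Context: Notation: $\Gamma(\Xi)$ is the set of smooth sections of a vector bundle $\Xi$. Indefinite nearly Sasakian manifold: a $(2n+1)$-dimensional manifold $\overline{M}$ with a $(1,1)$-tensor $\overline{\phi}$, a vector field $\xi$, a 1-form $\eta$ and a semi-Riemannian metric $\overline{g}$ with Levi-Civita connection $\overline{\nabla}$ such that $\overline{\phi}^2=-I+\eta\otimes\xi$, $\eta(\xi)=1$, $\eta\circ\overline{\phi}=0$, $\overline{\phi}\xi=0$, $\overline{g}(\overline{\phi}X,\overline{\phi}Y)=\overline{g}(X,Y)-\eta(X)\eta(Y)$ (hence $\eta=\overline{g}(\xi,\cdot)$), and $(\overline{\nabla}_X\overline{\phi})Y+(\overline{\nabla}_Y\overline{\phi})X=2\overline{g}(X,Y)\xi-\eta(Y)X-\eta(X)Y$ for all $X,Y$. Lightlike submanifold: a submanifold $M$ of $\overline{M}$, with $g$ the induced (degenerate) metric, such that $\mathrm{Rad}\,TM=TM\cap TM^\perp$ is a smooth distribution of rank $r>0$. A screen distribution $S(TM)$ is a semi-Riemannian (non-degenerate) complement of $\mathrm{Rad}\,TM$ in $TM$; $S(TM^\perp)$ is a semi-Riemannian complement of $\mathrm{Rad}\,TM$ in $TM^\perp$. The lightlike transversal bundle $l\mathrm{tr}(TM)$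 is locally spanned by null sections $N_i$ of the orthogonal complement of $S(TM^\perp)$ in $S(TM)^\perp$ with $\overline{g}(E_i,N_j)=\delta_{ij}$, $\overline g(N_i,N_j)=0$ for a local basis $\{E_i\}$ of $\mathrm{Rad}\,TM$. Put $\mathrm{tr}(TM)=l\mathrm{tr}(TM)\perp S(TM^\perp)$, so $T\overline{M}|_M=TM\oplus\mathrm{tr}(TM)=S(TM)\perp S(TM^\perp)\perp\{\mathrm{Rad}\,TM\oplus l\mathrm{tr}(TM)\}$. The Gauss formula is $\overline{\nabla}_XY=\nabla_XY+h(X,Y)$ for $X,Y\in\Gamma(TM)$, with $\nabla_XY\in\Gamma(TM)$ and $h(X,Y)\in\Gamma(\mathrm{tr}(TM))$ (the second fundamental form). $M$ is totally umbilical if there is a smooth $\mathcal{H}\in\Gamma(\mathrm{tr}(TM))$ with $h(X,Y)=\mathcal{H}g(X,Y)$ for all $X,Y\in\Gamma(TM)$. QGCR-lightlike submanifold: a lightlike submanifold $(M,g,S(TM),S(TM^\perp))$ of $\overline{M}$ is Quasi Generalized Cauchy-Riemann (QGCR) if (i) there are distributions $D_1,D_2$ of $\mathrm{Rad}\,TM$ with $\mathrm{Rad}\,TM=D_1\oplus D_2$, $\overline{\phi}D_1=D_1$, $\overline{\phi}D_2\subset S(TM)$; (ii) there are subbundles $D_0,\overline{D}$ of $S(TM)$ with $S(TM)=\{\overline{\phi}D_2\oplus\overline{D}\}\perp D_0$, $\overline{\phi}D_0\subseteq D_0$, $\overline{D}=\overline{\phi}\mathcal{S}\oplus\overline{\phi}\mathcal{L}$,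 where $D_0$ is non-degenerate and $\mathcal{L}$, $\mathcal{S}$ are vector subbundles of $l\mathrm{tr}(TM)$ and $S(TM^\perp)$ respectively. In (ii) the symbol $\oplus$ denotes a (not necessarily orthogonal) sum of subbundles, and the summands $\overline{\phi}D_2$ and $\overline{\phi}\mathcal{L}$ are allowed to intersect. $M$ is proper if $D_0,D_1,D_2,\mathcal{S}$ are all nonzero. *)

(* Defs.v *)
From HB Require Import structures.
From mathcomp Require Import all_boot all_order all_algebra.
From mathcomp Require Import all_classical all_reals all_analysis.

Set Implicit Arguments.
Unset Strict Implicit.
Unset Printing Implicit Defensive.

Import Order.TTheory GRing.Theory Num.Theory.
Import numFieldNormedType.Exports.
Local Open Scope classical_set_scope.
Local Open Scope ring_scope.

Fixpoint Ck (R : realType) (n : nat) (W : normedModType R) (k : nat)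
    (U : set 'rV[R]_n) (F : 'rV[R]_n -> W) : Prop :=
  if k is k'.+1 then
    (forall y, U y -> differentiable F y) /\
    (forall v : 'rV[R]_n, Ck k' U (fun y => 'D_v F y))
  else forall y, U y -> {for y, continuous F}.

Definition smooth_on (R : realType) (n : nat) (W : normedModType R)
    (U : set 'rV[R]_n) (F : 'rV[R]_n -> W) : Prop :=
  forall k, Ck k U F.

Definition smooth_near (R : realType) (n : nat) (W : normedModType R)
    (y : 'rV[R]_n) (F : 'rV[R]_n -> W) : Prop :=
  exists U : set 'rV[R]_n, [/\ open U, U y & smooth_on U F].

(* The atlas is indexed by the points: [chart p], with domain [dom p] and
   inverse [param p], is a chart around p.  This loses no generality (choose a
   chart around each point) and gives every tangent space a preferred basis:
   an element of T_p M is a row vector, its components in [chart p]. *)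
Record manifold (R : realType) (n : nat) := Manifold {
  carrier :> topologicalType ;
  dom : carrier -> set carrier ;
  chart : carrier -> carrier -> 'rV[R]_n ;
  param : carrier -> 'rV[R]_n -> carrier ;
  dom_open : forall p, open (dom p) ;
  dom_center : forall p, dom p p ;
  cod_open : forall p, open (chart p @` dom p) ;
  chartK : forall p q, dom p q -> param p (chart p q) = q ;
  chart_continuous : forall p q, dom p q -> {for q, continuous (chart p)} ;
  param_continuous :
    forall p q, dom p q -> {for chart p q, continuous (param p)} ;
  transition_smooth : forall p q,
    smooth_on (chart p @` (dom p `&` dom q)) (chart q \o param p) ;
  manifold_hausdorff : hausdorff_space carrier ;
  manifold_second_countable : @second_countable carrier }.

Section Calculus.
Context {R : realType} {n : nat} {M : manifold R n}.

(* For v in T_q M, the components of v in [chart p]. *)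
Definition chart_coord (p q : M) (v : 'rV[R]_n) : 'rV[R]_n :=
  'd (chart p \o param q) (chart q q) v.

Definition local_rep (p : M) (X : M -> 'rV[R]_n) (y : 'rV[R]_n) : 'rV[R]_n :=
  chart_coord p (param p y) (X (param p y)).

Definition smooth_fun (p : M) (a : M -> R) : Prop :=
  smooth_near (chart p p) (a \o param p : _ -> R^o).

Definition smooth_field (p : M) (X : M -> 'rV[R]_n) : Prop :=
  smooth_near (chart p p) (local_rep p X).

(* The derivative v(a) of a function a along v in T_p M. *)
Definition dirder (p : M) (v : 'rV[R]_n) (a : M -> R) : R :=
  'D_v (a \o param p : _ -> R^o) (chart p p).

Definition bracket (X Y : M -> 'rV[R]_n) (p : M) : 'rV[R]_n :=
  'D_(X p) (local_rep p Y) (chart p p) - 'D_(Y p) (local_rep p X) (chart p p).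

End Calculus.

(* Subspaces are row spaces of square matrices, a bilinear form is its Gram
   matrix, and an endomorphism acts on the right of row vectors. *)

Definition inner (R : realType) (n : nat) (G : 'M[R]_n) (u v : 'rV[R]_n) : R :=
  (u *m G *m v^T) 0 0.

Definition orth_compl (R : realType) (n : nat) (G A : 'M[R]_n) : 'M[R]_n :=
  kermx (G *m A^T).

Definition nondegenerate (R : realType) (n : nat) (G A : 'M[R]_n) : Prop :=
  (A :&: orth_compl G A)%MS = 0.

Definition direct_sum (R : realType) (n : nat) (C A B : 'M[R]_n) : Prop :=
  (C :=: A + B)%MS /\ (A :&: B)%MS = 0.

Record semi_riemannian (R : realType) (n : nat) (M : manifold R n)
    (g : M -> 'M[R]_n) : Prop := SemiRiemannian {
  metric_sym : forall p, (g p)^T = g p ;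
  metric_unit : forall p, g p \in unitmx ;
  (* as for phi and eta below, smoothness of a tensor field is tested on local
     vector fields *)
  metric_smooth : forall p (X Y : M -> 'rV[R]_n),
    smooth_field p X -> smooth_field p Y ->
    smooth_fun p (fun q => inner (g q) (X q) (Y q)) }.

(* [nabla Y p v] is the covariant derivative at p of Y along v in T_p M.  It is
   constrained only when Y is smooth near p; that it then depends only on the
   germ of Y at p is the case of the Leibniz rule where a is the indicator
   function of a neighbourhood of p. *)
Record levi_civita (R : realType) (n : nat) (M : manifold R n)
    (g : M -> 'M[R]_n)
    (nabla : (M -> 'rV[R]_n) -> M -> 'rV[R]_n -> 'rV[R]_n) : Prop :=
  LeviCivita {
  nabla_linear : forall p Y (c : R) (u v : 'rV[R]_n), smooth_field p Y ->
    nabla Y p (c *: u + v) = c *: nabla Y p u + nabla Y p v ;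
  nabla_add : forall p Y Z v, smooth_field p Y -> smooth_field p Z ->
    nabla (fun q => Y q + Z q) p v = nabla Y p v + nabla Z p v ;
  nabla_leibniz : forall p (a : M -> R) Y v,
    smooth_fun p a -> smooth_field p Y ->
    nabla (fun q => a q *: Y q) p v = a p *: nabla Y p v + dirder p v a *: Y p ;
  nabla_smooth : forall p X Y, smooth_field p X -> smooth_field p Y ->
    smooth_field p (fun q => nabla Y q (X q)) ;
  nabla_torsion : forall p X Y, smooth_field p X -> smooth_field p Y ->
    nabla Y p (X p) - nabla X p (Y p) = bracket X Y p ;
  nabla_metric : forall p Y Z v, smooth_field p Y -> smooth_field p Z ->
    dirder p v (fun q => inner (g q) (Y q) (Z q)) =
    inner (g p) (nabla Y p v) (Z p) + inner (g p) (Y p) (nabla Z p v) }.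

(* (nabla_v phi) Y at p *)
Definition nabla_endo (R : realType) (n : nat) (M : manifold R n)
    (nabla : (M -> 'rV[R]_n) -> M -> 'rV[R]_n -> 'rV[R]_n)
    (phi : M -> 'M[R]_n) (Y : M -> 'rV[R]_n) (p : M) (v : 'rV[R]_n) :
    'rV[R]_n :=
  nabla (fun q => Y q *m phi q) p v - nabla Y p v *m phi p.

Definition form_val (R : realType) (n : nat) (w : 'cV[R]_n)
    (v : 'rV[R]_n) : R := (v *m w) 0 0.

Record nearly_sasakian (R : realType) (n : nat) (M : manifold R n.*2.+1)
    (g : M -> 'M[R]_(n.*2.+1))
    (nabla : (M -> 'rV[R]_(n.*2.+1)) -> M ->
             'rV[R]_(n.*2.+1) -> 'rV[R]_(n.*2.+1))
    (phi : M -> 'M[R]_(n.*2.+1)) (xi : M -> 'rV[R]_(n.*2.+1))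
    (eta : M -> 'cV[R]_(n.*2.+1)) : Prop := NearlySasakian {
  ns_metric : semi_riemannian g ;
  ns_levi_civita : levi_civita g nabla ;
  phi_smooth : forall p X, smooth_field p X ->
    smooth_field p (fun q => X q *m phi q) ;
  xi_smooth : forall p, smooth_field p xi ;
  eta_smooth : forall p X, smooth_field p X ->
    smooth_fun p (fun q => form_val (eta q) (X q)) ;
  phi_sq : forall p v, v *m phi p *m phi p = - v + form_val (eta p) v *: xi p ;
  eta_xi : forall p, form_val (eta p) (xi p) = 1 ;
  eta_phi : forall p v, form_val (eta p) (v *m phi p) = 0 ;
  phi_xi : forall p, xi p *m phi p = 0 ;
  metric_phi : forall p u v,
    inner (g p) (u *m phi p) (v *m phi p) =
    inner (g p) u v - form_val (eta p) u * form_val (eta p) v ;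
  ns_identity : forall p X Y, smooth_field p X -> smooth_field p Y ->
    nabla_endo nabla phi Y p (X p) + nabla_endo nabla phi X p (Y p) =
    (2 * inner (g p) (X p) (Y p)) *: xi p
      - form_val (eta p) (Y p) *: X p - form_val (eta p) (X p) *: Y p }.

Section Submanifold.
Context {R : realType} {n m : nat} {Mb : manifold R n} {M : manifold R m}.
Variables (f : M -> Mb) (g : Mb -> 'M[R]_n).

Definition map_rep (x : M) : 'rV[R]_m -> 'rV[R]_n :=
  chart (f x) \o f \o param x.

Definition differential (x : M) : 'M[R]_(m, n) :=
  jacobian (map_rep x) (chart x x).

(* M is an immersed submanifold, f being the inclusion. *)
Record submanifold : Prop := Submanifold {
  sub_injective : injective f ;
  sub_continuous : continuous f ;
  sub_smooth : forall x, smooth_near (chart x x) (map_rep x) ;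
  sub_immersion : forall x, row_free (differential x) }.

(* Subbundles of TMb restricted to M are given by their fibres, subspaces of
   T_(f x) Mb; sections are functions V with V x in T_(f x) Mb. *)

Definition TM (x : M) : 'M[R]_n := <<differential x>>%MS.

Definition TMperp (x : M) : 'M[R]_n := orth_compl (g (f x)) (TM x).

Definition Rad (x : M) : 'M[R]_n := (TM x :&: TMperp x)%MS.

Definition smooth_section (x : M) (V : M -> 'rV[R]_n) : Prop :=
  smooth_near (chart x x)
    (fun y => chart_coord (f x) (f (param x y)) (V (param x y))).

Definition local_frame (k : nat) (B : M -> 'M[R]_n) (x : M)
    (V : 'I_k -> M -> 'rV[R]_n) : Prop :=
  (forall i, smooth_section x (V i)) /\
  (\forall y \near x, row_free (\matrix_i V i y) /\
                      (\matrix_i V i y :=: B y)%MS).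

Definition subbundle (k : nat) (B : M -> 'M[R]_n) : Prop :=
  forall x, exists V : 'I_k -> M -> 'rV[R]_n, local_frame B x V.

Definition is_subbundle (B : M -> 'M[R]_n) : Prop := exists k, subbundle k B.

Definition nonzero_bundle (B : M -> 'M[R]_n) : Prop := exists x, B x != 0.

Definition is_screen (ST : M -> 'M[R]_n) : Prop :=
  [/\ is_subbundle ST,
      forall x, direct_sum (TM x) (Rad x) (ST x) &
      forall x, nondegenerate (g (f x)) (ST x)].

Definition is_screen_transversal (STp : M -> 'M[R]_n) : Prop :=
  [/\ is_subbundle STp,
      forall x, direct_sum (TMperp x) (Rad x) (STp x) &
      forall x, nondegenerate (g (f x)) (STp x)].

(* Given ST and STp, there is exactly one such bundle ltr. *)
Definition is_lightlike_transversal (r : nat)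
    (ST STp ltr : M -> 'M[R]_n) : Prop :=
  forall x, exists E N : 'I_r -> M -> 'rV[R]_n,
    [/\ local_frame Rad x E,
        local_frame ltr x N &
        \forall y \near x, forall i j : 'I_r,
          [/\ (N i y <= orth_compl (g (f y)) (ST y)
                      :&: orth_compl (g (f y)) (STp y))%MS,
              inner (g (f y)) (E i y) (N j y) = (i == j)%:R &
              inner (g (f y)) (N i y) (N j y) = 0]].

Record lightlike_submanifold (ST STp ltr : M -> 'M[R]_n) : Prop :=
  LightlikeSubmanifold {
  ls_submanifold : submanifold ;
  ls_screen : is_screen ST ;
  ls_screen_transversal : is_screen_transversal STp ;
  ls_rad : exists r, [/\ (0 < r)%N, subbundle r Rad &
                         is_lightlike_transversal r ST STp ltr] }.

Definition transversal (STp ltr : M -> 'M[R]_n) (x : M) : 'M[R]_n :=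
  (ltr x + STp x)%MS.

(* Since f is an immersion, the germs at x of smooth sections of TM are exactly
   the germs of Y \o f for such fields Y on Mb; for v tangent to M, nabla_v Y
   depends on Y \o f only, and this is the meaning of nabla_v (Y \o f). *)
Definition tangent_along (x : M) (Y : Mb -> 'rV[R]_n) : Prop :=
  smooth_field (f x) Y /\ \forall y \near x, (Y (f y) <= TM y)%MS.

(* h(X, Y) at x: the component in tr(TM) of nabla_X Y for the decomposition
   TMb = TM (+) tr(TM); X is a vector at x and Y is as in [tangent_along]. *)
Definition second_fundamental_form
    (nabla : (Mb -> 'rV[R]_n) -> Mb -> 'rV[R]_n -> 'rV[R]_n)
    (STp ltr : M -> 'M[R]_n) (x : M) (X : 'rV[R]_n) (Y : Mb -> 'rV[R]_n) :
    'rV[R]_n :=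
  nabla Y (f x) X *m proj_mx (transversal STp ltr x) (TM x).

Definition totally_umbilical
    (nabla : (Mb -> 'rV[R]_n) -> Mb -> 'rV[R]_n -> 'rV[R]_n)
    (STp ltr : M -> 'M[R]_n) : Prop :=
  exists H : M -> 'rV[R]_n,
    [/\ forall x, smooth_section x H,
        forall x, (H x <= transversal STp ltr x)%MS &
        forall x X Y, (X <= TM x)%MS -> tangent_along x Y ->
          second_fundamental_form nabla STp ltr x X Y =
          inner (g (f x)) X (Y (f x)) *: H x].

Definition phi_image (phi : Mb -> 'M[R]_n) (B : M -> 'M[R]_n) (x : M) :
  'M[R]_n := B x *m phi (f x).

Record QGCR (phi : Mb -> 'M[R]_n) (ST STp ltr : M -> 'M[R]_n)
    (D1 D2 D0 Dbar L S : M -> 'M[R]_n) : Prop := IsQGCR {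
  q_D1 : is_subbundle D1 ;
  q_D2 : is_subbundle D2 ;
  q_Rad : forall x, direct_sum (Rad x) (D1 x) (D2 x) ;
  q_phi_D1 : forall x, (phi_image phi D1 x :=: D1 x)%MS ;
  q_phi_D2 : forall x, (phi_image phi D2 x <= ST x)%MS ;
  q_D0 : is_subbundle D0 ;
  q_Dbar : is_subbundle Dbar ;
  q_L : is_subbundle L ;
  q_L_sub : forall x, (L x <= ltr x)%MS ;
  q_S : is_subbundle S ;
  q_S_sub : forall x, (S x <= STp x)%MS ;
  (* phi D2 may meet the summand phi L of Dbar, so phi D2 + Dbar need not be
     direct *)
  q_ST : forall x,
    direct_sum (ST x) (phi_image phi D2 x + Dbar x)%MS (D0 x) ;
  q_ST_orth : forall x,
    (phi_image phi D2 x + Dbar x <= orth_compl (g (f x)) (D0 x))%MS ;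
  q_D0_nondeg : forall x, nondegenerate (g (f x)) (D0 x) ;
  q_phi_D0 : forall x, (phi_image phi D0 x <= D0 x)%MS ;
  q_Dbar_sum : forall x,
    (Dbar x :=: phi_image phi S x + phi_image phi L x)%MS }.

Definition proper_QGCR (phi : Mb -> 'M[R]_n)
    (ST STp ltr : M -> 'M[R]_n) : Prop :=
  exists D1 D2 D0 Dbar L S : M -> 'M[R]_n,
    QGCR phi ST STp ltr D1 D2 D0 Dbar L S /\
    [/\ nonzero_bundle D0, nonzero_bundle D1, nonzero_bundle D2 &
        nonzero_bundle S].

End Submanifold.

(* Main.v *)
(* Already S must vanish.  Since nabla_xi xi = 0, umbilicity gives
   H = g(xi, xi) H = h(xi, xi) = 0, so M is totally geodesic.  The structure
   equation gives g(phi v, nabla_v xi) = - g(phi v, phi v) for all v.  For W in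
   S and v = phi W, which is tangent to M, phi v = - W is normal to M whereas
   nabla_v xi is tangent, so g(W, W) = 0: S is totally isotropic.  Hence phi S
   is orthogonal to every summand of S(TM); being contained in the
   nondegenerate S(TM), it is zero, and phi is injective on S. *)
Require Import Defs.
From HB Require Import structures.
From mathcomp Require Import all_boot all_order all_algebra.
From mathcomp Require Import all_classical all_reals all_analysis.
From mathcomp Require Import lra.

Set Implicit Arguments.
Unset Strict Implicit.
Unset Printing Implicit Defensive.

Import Order.TTheory GRing.Theory Num.Theory.
Import numFieldNormedType.Exports.
Local Open Scope classical_set_scope.
Local Open Scope ring_scope.

(** * Locality of differentials and of smoothness *)

Lemma near_eq_is_diff (R : realType) (V W : normedModType R) (f h : V -> W)
    (x : V) (df : V -> W) :
  {near x, f =1 h} -> is_diff x f df -> is_diff x h df.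
Proof.
move=> fh [/[dup] dfx /diff_locallyP[cdf Ef] <-].
(* The first-order expansion at [x] depends only on the germ, so that of [f] carries over to [h];
   uniqueness then identifies the differentials. *)
have Eh : h \o shift x = cst (h x) + 'd f x +o_ (0 : V) id.
  rewrite -(nbhs_singleton fh).
  have /eqaddoP Ef' := Ef.
  apply/eqaddoP => e e0; have := Ef' e e0.
  apply: filter_app; rewrite near_simpl.
  have : \forall y \near 0, f (y + x) = h (y + x).
    rewrite (near_shift x)/=; near=> y.
    by rewrite /= sub0r subrK; near: y.
  apply: filter_app; near=> y => fhy.
  by rewrite -![(_ - _) y]/((_ \o _) _ - _) /= fhy.
have dh : 'd h x = 'd f x :> (V -> W) by exact: diff_unique.
apply: DiffDef; last exact: dh.
by apply/diff_locallyP; rewrite dh; split; [exact: cdf|exact: Eh].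
Unshelve. all: by end_near. Qed.

Lemma Ck_cst (R : realType) (n : nat) (W : normedModType R) (k : nat)
    (U : set 'rV[R]_n) (F : 'rV[R]_n -> W) (c : W) :
  open U -> (forall y, U y -> F y = c) -> Ck k U F.
Proof.
move=> oU; have nU y : U y -> \forall z \near y, U z.
  by move=> Uy; exact: open_nbhs_nbhs.
have ncst (F' : 'rV[R]_n -> W) d y : (forall z, U z -> F' z = d) -> U y ->
    {near y, cst d =1 F'}.
  by move=> F'd Uy; near=> z; rewrite /= F'd //; near: z; exact: nU.
elim: k F c => [|k IH] F c Fc.
  move=> y Uy; have : F @ y --> c; last by rewrite -[in X in X -> _](Fc y Uy).
  exact: (cvg_trans (near_eq_cvg (ncst F c y Fc Uy)) (cvg_cst c)).
split=> [y Uy|v].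
  by have [] := near_eq_is_diff (ncst F c y Fc Uy) (is_diff_cst c y).
(* Directional derivatives of [F] vanish on the open set [U], so they fall under the induction
   hypothesis with constant 0. *)
apply: (IH _ 0) => y Uy.
by rewrite -(near_eq_derive v (ncst F c y Fc Uy)) derive_cst.
Unshelve. all: by end_near. Qed.

(** * Extension of a tangent vector to a smooth local field *)

Section ConstantField.
Context {R : realType} {n : nat} {M : manifold R n}.
Implicit Types (p q : M) (v : 'rV[R]_n).

Lemma transition_differentiable p q : dom p q ->
  differentiable (chart q \o param p) (chart p q).
Proof.
move=> pq; have [+ _] := transition_smooth p q 1%N.
by apply; exists q => //; split=> //; exact: dom_center.
Qed.

Lemma transition_center_differentiable p q : dom p q ->
  differentiable (chart p \o param q) (chart q q).
Proof.
move=> pq; have [+ _] := transition_smooth q p 1%N.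
by apply; exists q => //; split=> //; exact: dom_center.
Qed.

(** The equality holds at any [y] in the image of [chart p] with [param p y] in [dom q]; both are
    open conditions, the second by continuity of [param p]. *)
Lemma near_transitionK p q : dom p q ->
  {near chart p q, id =1 (chart p \o param q) \o (chart q \o param p)}.
Proof.
move=> pq.
have Up : \forall y \near chart p q, (chart p @` dom p) y.
  by apply: open_nbhs_nbhs; split; [exact: cod_open|exists q].
have Uq : \forall y \near chart p q, dom q (param p y).
  have /(_ (dom q)) := param_continuous pq; apply.
  apply: open_nbhs_nbhs; split; first exact: dom_open.
  by rewrite chartK//; exact: dom_center.
near=> y; have [z pz zy] : (chart p @` dom p) y by near: y.
have : dom q (param p y) by near: y.
by rewrite -zy /= chartK // => qz; rewrite chartK.
Unshelve. all: by end_near. Qed.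

(* The field with constant components v in [chart p]. *)
Definition chart_cst_field p v q : 'rV[R]_n :=
  'd (chart q \o param p) (chart p q) v.

(** Chain rule: the two transition maps compose to the identity near [chart p q], so their
    differentials are inverse to each other. *)
Lemma chart_coord_cst_field p v q : dom p q ->
  chart_coord p q (chart_cst_field p v q) = v.
Proof.
move=> pq; rewrite /chart_coord /chart_cst_field.
have := diff_comp (transition_differentiable pq).
rewrite /= chartK // => /(_ _ _ (transition_center_differentiable pq)).
move=> /(congr1 (fun h => h v)) /= <-.
have [_ ->] := near_eq_is_diff (near_transitionK pq) (is_diff_id _).
by [].
Qed.

Lemma smooth_chart_cst_field p v : smooth_field p (chart_cst_field p v).
Proof.
exists (chart p @` dom p); split; first exact: cod_open.
  by exists p => //; exact: dom_center.
move=> k; apply: (@Ck_cst _ _ _ _ _ _ v); first exact: cod_open.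
move=> _ [q pq <-]; rewrite /local_rep chartK //.
exact: chart_coord_cst_field.
Qed.

Lemma chart_cst_field_center p v : chart_cst_field p v p = v.
Proof.
have pp := dom_center p.
rewrite /chart_cst_field.
have E : {near chart p p, id =1 chart p \o param p}.
  have : \forall y \near chart p p, (chart p @` dom p) y.
    by apply: open_nbhs_nbhs; split; [exact: cod_open|exists p].
  by apply: filterS => _ [q pq <-] /=; rewrite chartK.
by have [_ ->] := near_eq_is_diff E (is_diff_id _).
Qed.

End ConstantField.

(** * Linear algebra of a bilinear form on row spaces *)

Section Inner.
Context {R : realType} {n : nat}.
Implicit Types (G A B : 'M[R]_n) (u v w : 'rV[R]_n).

Lemma innerDl G u v w : inner G (u + v) w = inner G u w + inner G v w.
Proof. by rewrite /inner !mulmxDl mxE. Qed.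

Lemma innerNl G u w : inner G (- u) w = - inner G u w.
Proof. by rewrite /inner !mulNmx mxE. Qed.

Lemma innerNr G u w : inner G u (- w) = - inner G u w.
Proof. by rewrite /inner linearN mulmxN mxE. Qed.

Lemma innerZl G (c : R) u w : inner G (c *: u) w = c * inner G u w.
Proof. by rewrite /inner -!scalemxAl mxE. Qed.

Lemma innerDr G u v w : inner G u (v + w) = inner G u v + inner G u w.
Proof. by rewrite /inner linearD mulmxDr mxE. Qed.

Lemma inner0r G u : inner G u 0 = 0.
Proof. by rewrite /inner trmx0 mulmx0 mxE. Qed.

Lemma innerC G u v : G^T = G -> inner G u v = inner G v u.
Proof.
move=> symG; rewrite /inner -[in LHS](trmxK (u *m G *m v^T)) mxE.
by rewrite !trmx_mul trmxK symG mulmxA.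
Qed.

Lemma inner_suml G k (a : 'rV[R]_k) (E : 'I_k -> 'rV[R]_n) w :
  inner G (a *m \matrix_i E i) w = \sum_i a 0 i * inner G (E i) w.
Proof.
rewrite /inner (mulmx_sum_row a) !mulmx_suml summxE.
by apply: eq_bigr => i _; rewrite rowK -!scalemxAl mxE.
Qed.

Lemma orth_complP G A u :
  reflect (forall v, (v <= A)%MS -> inner G u v = 0) (u <= orth_compl G A)%MS.
Proof.
apply: (iffP sub_kermxP) => [uA v /submxP[w ->]|uA].
  by rewrite /inner trmx_mul mulmxA -(mulmxA u) uA mul0mx mxE.
apply/rowP => j; rewrite [RHS]mxE -(uA (row j A)) ?row_sub //.
by rewrite /inner tr_row colE mulmxA -colE [RHS]mxE mulmxA.
Qed.

Lemma sub_orth_complP G A B :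
  reflect (forall u v, (u <= A)%MS -> (v <= B)%MS -> inner G u v = 0)
          (A <= orth_compl G B)%MS.
Proof.
apply: (iffP idP) => [AB u v uA|AB].
  by move: v; apply/orth_complP/(submx_trans uA).
by apply/row_subP => i; apply/orth_complP => v; apply: AB; exact: row_sub.
Qed.

Lemma nondegenerate_eq0 G A u : Defs.nondegenerate G A -> (u <= A)%MS ->
  (forall v, (v <= A)%MS -> inner G u v = 0) -> u = 0.
Proof.
move=> ndA uA u0; apply/eqP; rewrite -submx0 -[X in (_ <= X)%MS]ndA.
by rewrite sub_capmx uA; exact/orth_complP.
Qed.

(** A trivial kernel forces [G *m A^T] to have full rank, and this rank is at most that of [A]. *)
Lemma orth_compl0_full G A :
  (forall u, (u <= orth_compl G A)%MS -> u = 0) -> row_full A.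
Proof.
move=> A0; have : orth_compl G A == 0.
  by apply/eqP/row_matrixP => i; rewrite row0; apply: A0; exact: row_sub.
rewrite kermx_eq0 /row_full eqn_leq rank_leq_col => /eqP rk.
by rewrite -mxrank_tr -[X in (X <= _)%N]rk mxrankM_maxr.
Qed.

Lemma orth_compl_sym G A B : G^T = G ->
  (A <= orth_compl G B)%MS -> (B <= orth_compl G A)%MS.
Proof.
move=> symG /sub_orth_complP AB; apply/sub_orth_complP => u v uB vA.
by rewrite innerC // AB.
Qed.

End Inner.

(** * Splitting of the ambient tangent space into tangent and transversal parts *)

Section Lightlike.
Context {R : realType} {n m : nat} {Mb : manifold R n} {M : manifold R m}.
Variables (f : M -> Mb) (g : Mb -> 'M[R]_n) (ST STp ltr : M -> 'M[R]_n).
Hypotheses (sr : semi_riemannian g)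
  (ls : lightlike_submanifold f g ST STp ltr).
Implicit Types (x : M) (u v : 'rV[R]_n).

Let symg x : (g (f x))^T = g (f x) := Defs.metric_sym sr (f x).

Lemma rad_ltr_frames x : exists r (E N : 'I_r -> 'rV[R]_n),
  [/\ (\matrix_i E i :=: Rad f g x)%MS, (\matrix_i N i :=: ltr x)%MS,
      forall i, (N i <= orth_compl (g (f x)) (STp x))%MS &
      forall i j, inner (g (f x)) (E i) (N j) = (i == j)%:R].
Proof.
have [r [_ _ /(_ x)[E [N [[_ /nbhs_singleton[_ EE]] [_ /nbhs_singleton[_ NN]]
  /nbhs_singleton EN]]]]] := ls_rad ls.
exists r, (E ^~ x), (N ^~ x); split => // [i|i j].
  by have [+ _ _] := EN i i; rewrite sub_capmx => /andP[].
by have [_ + _] := EN i j.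
Qed.

Lemma ltr_orth_STp x : (ltr x <= orth_compl (g (f x)) (STp x))%MS.
Proof.
have [r [E [N [_ <- NSTp _]]]] := rad_ltr_frames x.
by apply/row_subP => i; rewrite rowK.
Qed.

(** The frames of [Rad] and [ltr] are dual, so pairing with [N j] reads off the [j]-th coefficient
    of [u]. *)
Lemma rad_ltr_eq0l x u : (u <= Rad f g x)%MS ->
  (forall v, (v <= ltr x)%MS -> inner (g (f x)) u v = 0) -> u = 0.
Proof.
have [r [E [N [<- NN _ EN]]]] := rad_ltr_frames x.
move=> /submxP[a ->] u0; rewrite (_ : a = 0) ?mul0mx //.
apply/rowP => j; rewrite mxE -[RHS](u0 (N j)); last first.
  by rewrite -NN -[N j](rowK N) row_sub.
rewrite inner_suml (bigD1 j) //= big1 ?addr0 => [|i ij].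
  by rewrite EN eqxx mulr1.
by rewrite EN (negPf ij) mulr0.
Qed.

Lemma rad_ltr_eq0r x v : (v <= ltr x)%MS ->
  (forall u, (u <= Rad f g x)%MS -> inner (g (f x)) u v = 0) -> v = 0.
Proof.
have [r [E [N [EE <- _ EN]]]] := rad_ltr_frames x.
move=> /submxP[a ->] u0; rewrite (_ : a = 0) ?mul0mx //.
apply/rowP => j; rewrite mxE -[RHS](u0 (E j)); last first.
  by rewrite -EE -[E j](rowK E) row_sub.
rewrite innerC // inner_suml (bigD1 j) //= big1 ?addr0 => [|i ij].
  by rewrite innerC // EN eqxx mulr1.
by rewrite innerC // EN eq_sym (negPf ij) mulr0.
Qed.

Lemma screen_sub x : (ST x <= TM f x)%MS.
Proof.
by have [_ /(_ x)[-> _] _] := ls_screen ls; exact: addsmxSr.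
Qed.

Lemma screen_transversal_sub x : (STp x <= TMperp f g x)%MS.
Proof.
by have [_ /(_ x)[-> _] _] := ls_screen_transversal ls; exact: addsmxSr.
Qed.

Lemma TMperp_inner x u v : (u <= TMperp f g x)%MS -> (v <= TM f x)%MS ->
  inner (g (f x)) u v = 0.
Proof. by move=> /orth_complP; apply. Qed.

Lemma TM_transversal_disjoint x :
  (TM f x :&: Defs.transversal STp ltr x)%MS = 0.
Proof.
apply/eqP; rewrite -submx0; apply/row_subP => i; rewrite submx0.
move: (row i _) (row_sub i (TM f x :&: Defs.transversal STp ltr x)%MS) => t.
rewrite sub_capmx => /andP[tTM /sub_addsmxP[[a b] /= tE]].
have aL : (a *m ltr x <= ltr x)%MS by exact: submxMl.
have bS : (b *m STp x <= STp x)%MS by exact: submxMl.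
have bT := submx_trans bS (screen_transversal_sub x).
(* Both [t], being tangent, and its [STp] part are orthogonal to [Rad], hence so is the [ltr] part,
   which duality kills. *)
have a0 : a *m ltr x = 0.
  apply: rad_ltr_eq0r aL _ => u; rewrite sub_capmx => /andP[uT uP].
  rewrite -(addrK (b *m STp x) (a *m ltr x)) -tE innerC // innerDl innerNl.
  by rewrite innerC // (TMperp_inner uP) // (TMperp_inner bT) // subr0.
(* What remains lies in [TM], [TMperp] and [STp] at once, that is in [Rad] and its complement
   [STp]. *)
move: tTM; rewrite tE a0 add0r => bTM; rewrite -submx0.
have [_ /(_ x)[_ <-] _] := ls_screen_transversal ls.
by rewrite !sub_capmx bTM bT bS.
Qed.

(** A vector orthogonal to the sum lies in [TMperp], which is [Rad] plus [STp]. Nondegeneracy of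
    [STp] removes one component, duality with [ltr] the other. *)
Lemma TM_transversal_full x : row_full (TM f x + Defs.transversal STp ltr x)%MS.
Proof.
apply: orth_compl0_full => u /orth_complP u0.
have uT v : (v <= TM f x)%MS -> inner (g (f x)) u v = 0.
  by move=> vT; apply: u0; exact: submx_trans vT (addsmxSl _ _).
have uL v : (v <= ltr x)%MS -> inner (g (f x)) u v = 0.
  move=> vL; apply: u0; apply: submx_trans vL _.
  exact: submx_trans (addsmxSl _ _) (addsmxSr _ _).
have uS v : (v <= STp x)%MS -> inner (g (f x)) u v = 0.
  move=> vS; apply: u0; apply: submx_trans vS _.
  exact: submx_trans (addsmxSr _ _) (addsmxSr _ _).
have : (u <= TMperp f g x)%MS by apply/orth_complP.
have [_ /(_ x)[-> _] /(_ x) ndS] := ls_screen_transversal ls.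
move=> /sub_addsmxP[[a b] /= uE].
have aR : (a *m Rad f g x <= Rad f g x)%MS by exact: submxMl.
have bS : (b *m STp x <= STp x)%MS by exact: submxMl.
have b0 : b *m STp x = 0.
  apply: (nondegenerate_eq0 ndS bS) => v vS.
  rewrite -(addKr (a *m Rad f g x) (b *m STp x)) -uE innerDl innerNl uS //.
  rewrite innerC // (TMperp_inner (submx_trans vS (screen_transversal_sub x))).
    by rewrite oppr0 addr0.
  exact: submx_trans aR (capmxSl _ _).
have uR : (u <= Rad f g x)%MS by rewrite uE b0 addr0.
exact: rad_ltr_eq0l uR uL.
Qed.

Lemma second_fundamental_form_eq0 nabla x v (Y : Mb -> 'rV[R]_n) :
  second_fundamental_form f nabla STp ltr x v Y = 0 ->
  (nabla Y (f x) v <= TM f x)%MS.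
Proof.
move=> h0; rewrite -[nabla Y (f x) v](@add_proj_mx _ _ _
  (Defs.transversal STp ltr x) (TM f x)).
- by rewrite [X in X + _]h0 add0r proj_mx_sub.
- by rewrite capmxC TM_transversal_disjoint.
- by rewrite addsmxC submx_full // TM_transversal_full.
Qed.

End Lightlike.

(** * Covariant derivatives of the structure vector field *)

Section NearlySasakian.
Context {R : realType} {n : nat} {M : manifold R n.*2.+1}.
Variables (g : M -> 'M[R]_(n.*2.+1))
  (nabla : (M -> 'rV[R]_(n.*2.+1)) -> M -> 'rV[R]_(n.*2.+1) -> 'rV[R]_(n.*2.+1))
  (phi : M -> 'M[R]_(n.*2.+1)) (xi : M -> 'rV[R]_(n.*2.+1))
  (eta : M -> 'cV[R]_(n.*2.+1)).
Hypothesis ns : nearly_sasakian g nabla phi xi eta.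
Implicit Types (p : M) (u v : 'rV[R]_(n.*2.+1)).

Let symg p : (g p)^T = g p := Defs.metric_sym (ns_metric ns) p.
Let lc := ns_levi_civita ns.

Lemma eta_inner p u : form_val (eta p) u = inner (g p) u (xi p).
Proof.
have := metric_phi ns p u (xi p).
by rewrite (phi_xi ns) inner0r (eta_xi ns) mulr1 => /esym/subr0_eq.
Qed.

Lemma inner_xi p : inner (g p) (xi p) (xi p) = 1.
Proof. by rewrite -eta_inner (eta_xi ns). Qed.

Lemma phi_sq_horizontal p u : inner (g p) u (xi p) = 0 ->
  u *m phi p *m phi p = - u.
Proof. by move=> u0; rewrite (phi_sq ns) eta_inner u0 scale0r addr0. Qed.

Lemma inner_phi_horizontal p u v : inner (g p) u (xi p) = 0 ->
  inner (g p) (u *m phi p) (v *m phi p) = inner (g p) u v.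
Proof. by move=> u0; rewrite (metric_phi ns) eta_inner u0 mul0r subr0. Qed.

(** The zero field is the image of [xi] under [phi]. *)
Lemma smooth_field0 p : smooth_field p (fun _ : M => 0).
Proof.
have := phi_smooth ns (xi_smooth ns p).
by under eq_fun do rewrite (phi_xi ns).
Qed.

Lemma nabla0 p v : nabla (fun _ => 0) p v = 0.
Proof.
have := nabla_add lc v (smooth_field0 p) (smooth_field0 p).
under [X in nabla X]eq_fun do rewrite addr0.
by move=> /esym/(canRL (addrK _)); rewrite subrr.
Qed.

Lemma dirder_cst p v (c : R) : dirder p v (fun _ => c) = 0.
Proof. exact: derive_cst. Qed.

(** The structure identity at [X = Y = xi] shows that [phi] kills this vector, and constancy of
    [g(xi, xi)] that it is orthogonal to [xi]; on such vectors the square of [phi] is minus the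
    identity. *)
Lemma nabla_xi_xi p : nabla xi p (xi p) = 0.
Proof.
have xi_s := xi_smooth ns p.
have phi0 : nabla xi p (xi p) *m phi p = 0.
  have := ns_identity ns xi_s xi_s.
  rewrite /nabla_endo; under eq_fun do rewrite (phi_xi ns).
  rewrite nabla0 sub0r -opprD inner_xi (eta_xi ns) mulr1 scale1r.
  rewrite scaler_nat mulr2n addrK subrr => /eqP.
  by rewrite oppr_eq0 -mulr2n -scaler_nat scaler_eq0 pnatr_eq0 => /eqP.
have xi0 : inner (g p) (nabla xi p (xi p)) (xi p) = 0.
  have := nabla_metric lc (xi p) xi_s xi_s.
  under eq_fun do rewrite inner_xi.
  rewrite dirder_cst (innerC _ (nabla xi p (xi p))) // => /esym/eqP.
  by rewrite -mulr2n mulrn_eq0 => /eqP.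
by apply/eqP; rewrite -oppr_eq0 -(phi_sq_horizontal xi0) phi0 mul0mx.
Qed.

(* The [xi]-component of [(nabla_v phi) v = g(v,v) xi - eta(v) v], since
   [g(phi X, xi) = 0] identically. *)
Lemma inner_phi_nabla_xi p v :
  inner (g p) (v *m phi p) (nabla xi p v) =
  - inner (g p) (v *m phi p) (v *m phi p).
Proof.
(* The structure identity concerns fields, so [v] is extended to one smooth near [p]. *)
pose X := chart_cst_field p v.
have Xp : X p = v by exact: chart_cst_field_center.
have Xs : smooth_field p X by exact: smooth_chart_cst_field.
have := nabla_metric lc v (phi_smooth ns Xs) (xi_smooth ns p).
under eq_fun do rewrite -eta_inner (eta_phi ns).
rewrite dirder_cst /= Xp => /esym/eqP; rewrite addrC addr_eq0 => /eqP ->.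
congr (- _).
have := congr1 (fun w => inner (g p) w (xi p)) (ns_identity ns Xs Xs).
rewrite /nabla_endo Xp !(innerDl, innerNl, innerZl) -!eta_inner (eta_phi ns).
rewrite (metric_phi ns) (eta_xi ns) => H; lra.
Qed.

End NearlySasakian.

(** * Vanishing of [S] in the totally umbilical case *)

Theorem theorem4p1 (R : realType) (n m : nat)
    (Mb : manifold R n.*2.+1)
    (g : Mb -> 'M[R]_(n.*2.+1))
    (nabla : (Mb -> 'rV[R]_(n.*2.+1)) -> Mb ->
             'rV[R]_(n.*2.+1) -> 'rV[R]_(n.*2.+1))
    (phi : Mb -> 'M[R]_(n.*2.+1))
    (xi : Mb -> 'rV[R]_(n.*2.+1))
    (eta : Mb -> 'cV[R]_(n.*2.+1))
    (M : manifold R m) (f : M -> Mb)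
    (ST STp ltr : M -> 'M[R]_(n.*2.+1)) :
  nearly_sasakian g nabla phi xi eta ->
  lightlike_submanifold f g ST STp ltr ->
  (forall x : M, (xi (f x) <= TM f x)%MS) ->
  ~ (totally_umbilical f g nabla STp ltr /\ proper_QGCR f g phi ST STp ltr).
Proof.
move=> ns ls xiT [[H [_ _ hH]]].
(* Properness supplies a point [x] with [S x] nonzero; the goal becomes [S x == 0] at that point. *)
move=> [D1 [D2 [D0 [Dbar [L [S [q [_ _ _ [x /negP[]]]]]]]]]].
have sr := ns_metric ns.
pose G := g (f x); pose ph := phi (f x).
have symG : G^T = G by exact: Defs.metric_sym sr (f x).
have txi : tangent_along f x xi.
  by split; [exact: xi_smooth ns _|exact: nearW].
have H0 : H x = 0.
  rewrite -[H x]scale1r -(inner_xi ns (f x)) -hH //.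
  by rewrite /second_fundamental_form (nabla_xi_xi ns) mul0mx.
have nablaT v : (v <= TM f x)%MS -> (nabla xi (f x) v <= TM f x)%MS.
  move=> vT; apply: (second_fundamental_form_eq0 sr ls).
  by rewrite hH // H0 scaler0.
have ST_perp u v : (u <= S x)%MS -> (v <= TM f x)%MS -> inner G u v = 0.
  move=> uS; apply: TMperp_inner; apply: submx_trans uS _.
  exact: submx_trans (q_S_sub q x) (screen_transversal_sub ls x).
have S_hor u : (u <= S x)%MS -> inner G u (xi (f x)) = 0.
  by move=> uS; exact: ST_perp.
have phiS : (S x *m ph <= ST x)%MS.
  have [-> _] := q_ST q x; rewrite -/ph.
  apply: submx_trans (addsmxSl _ _); apply: submx_trans (addsmxSr _ _).
  by rewrite (q_Dbar_sum q x) addsmxSl.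
have S_null u : (u <= S x)%MS -> inner G u u = 0.
  move=> uS; have uphT : (u *m ph <= TM f x)%MS.
    apply: submx_trans (submxMr _ uS) _.
    exact: submx_trans phiS (screen_sub ls x).
  have := inner_phi_nabla_xi ns (f x) (u *m ph).
  rewrite (phi_sq_horizontal ns (S_hor u uS)) !innerNl innerNr.
  by rewrite (ST_perp _ _ uS (nablaT _ uphT)) opprK => /oppr_inj.
have S_isotropic u v : (u <= S x)%MS -> (v <= S x)%MS -> inner G u v = 0.
  (* Polarization. *)
  move=> uS vS; have := S_null (u + v) (addmx_sub uS vS).
  rewrite innerDl !innerDr (S_null u uS) (S_null v vS) (innerC v u symG) => E.
  lra.
(* [phi] preserves products with a factor orthogonal to [xi], as every vector of [S x] is, so
   orthogonality of [S x] to [B] passes to the images. *)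
have phiS_orth (B : 'M[R]_(n.*2.+1)) :
    (forall u v, (u <= S x)%MS -> (v <= B)%MS -> inner G u v = 0) ->
    (B *m ph <= orth_compl G (S x *m ph))%MS.
  move=> uB; apply: orth_compl_sym => //; apply/sub_orth_complP => u v.
  move=> /submxP[a ->] /submxP[b ->]; rewrite !mulmxA.
  by rewrite (inner_phi_horizontal ns) ?S_hor ?uB ?submxMl.
have ST_orth : (ST x <= orth_compl G (S x *m ph))%MS.
  have [-> _] := q_ST q x; rewrite !addsmx_sub (q_Dbar_sum q x) addsmx_sub.
  (* The summands in order: [phi D2], with [D2] inside [Rad] and so tangent; [phi S], by isotropy;
     [phi L], since [ltr] is orthogonal to [STp]; and [D0], orthogonal to [Dbar] by assumption. *)
  rewrite -!andbA; apply/and4P; split.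
  - apply: phiS_orth => u v uS vD; apply: ST_perp => //.
    have [RE _] := q_Rad q x.
    apply: submx_trans vD _; apply: submx_trans (addsmxSr (D1 x) _) _.
    by rewrite -RE capmxSl.
  - exact: phiS_orth.
  - apply: phiS_orth => u v uS vL; rewrite innerC //.
    have /sub_orth_complP := ltr_orth_STp ls x; apply.
      exact: submx_trans vL (q_L_sub q x).
    exact: submx_trans uS (q_S_sub q x).
  - apply: orth_compl_sym => //; apply: submx_trans (q_ST_orth q x).
    apply: submx_trans (addsmxSr _ _).
    by rewrite (q_Dbar_sum q x) addsmxSl.
have [_ _ /(_ x) ndST] := ls_screen ls.
have phiS0 : S x *m ph = 0.
  apply/eqP; rewrite -submx0 -[X in (_ <= X)%MS]ndST sub_capmx phiS.
  exact: orth_compl_sym.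
(* Applying [phi] twice to a row of [S x] gives its negative, but already the first application
   gives 0. *)
rewrite -submx0; apply/row_subP => i; rewrite submx0 -oppr_eq0.
rewrite -(phi_sq_horizontal ns (S_hor _ (row_sub i _))).
by rewrite -row_mul -/ph phiS0 row0 mul0mx.
Qed.
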